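(* If $D$ is a finite simple digraph of order $n$ with $\gamma_I(D)\geq 3$, then $r_I(D)\leq n-\Delta^+(D)-\gamma_I(D)+2$.
   Context: A finite simple digraph has no loops and no multiple arcs (oppositely oriented arcs allowed); $\Delta^+(D)$ is its maximum out-degree. An Italian dominating function (IDF) on $D$ is a function $f:V(D)\to\{0,1,2\}$ such that every vertex $v$ with $f(v)=0$ has at least two in-neighbors $w$ with $f(w)=1$ or at least one in-neighbor $w$ with $f(w)=2$; its weight is $\sum_u f(u)$ and $\gamma_I(D)$ is the minimum weight of an IDF. For a set $R$ of arcs not in $A(D)$ (between distinct vertices), $D+R$ is $D$ with these arcs added; $R$ is an Italian reinforcement set if $\gamma_I(D+R)<\gamma_I(D)$. The Italian reinforcement number $r_I(D)$ is the minimum size of such a set, defined to be $0$ if $\gamma_I(D)\leq 2$. *)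

(* Defs.v *)
From mathcomp Require Import all_boot.

Set Implicit Arguments.
Unset Strict Implicit.
Unset Printing Implicit Defensive.

(* A digraph on V is its arc relation [D : rel V], where [D u v] is the arc
   u -> v; it is simple when D is irreflexive. *)

Definition max_outdeg (V : finType) (D : rel V) : nat :=
  \max_(v : V) #|[set w | D v w]|.

Definition IDF (V : finType) (D : rel V) (f : {ffun V -> 'I_3}) : bool :=
  [forall v, (f v == 0 :> nat) ==>
    ((2 <= #|[set w | D w v & f w == 1 :> nat]|)
     || [exists w, D w v && (f w == 2 :> nat)])].

Definition weight (V : finType) (f : {ffun V -> 'I_3}) : nat := \sum_u f u.

(* [arg min] needs a starting point satisfying the predicate: the constant
   function 2 is always an IDF. *)
Definition gammaI (V : finType) (D : rel V) : nat :=
  weight [arg min_(f < [ffun=> ord_max] | IDF D f) weight f].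

Definition nonarcs (V : finType) (D : rel V) : {set V * V} :=
  [set a | (a.1 != a.2) && ~~ D a.1 a.2].

Definition add_arcs (V : finType) (D : rel V) (R : {set V * V}) : rel V :=
  [rel u v | D u v || ((u, v) \in R)].

Definition reinforcing (V : finType) (D : rel V) (R : {set V * V}) : bool :=
  (R \subset nonarcs D) && (gammaI (add_arcs D R) < gammaI D).

(* The starting point [nonarcs D] is reinforcing whenever 2 < gammaI D; see
   [reinforcing_nonarcs]. *)
Definition rI (V : finType) (D : rel V) : nat :=
  if gammaI D <= 2 then 0
  else #|[arg min_(R < nonarcs D | reinforcing D R) #|R| ]|.

Lemma IDF_const2 (V : finType) (D : rel V) : IDF D [ffun=> ord_max].
Proof. by apply/forallP=> v; rewrite ffunE. Qed.

Lemma gammaI_attained (V : finType) (D : rel V) :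
  exists2 f, IDF D f & gammaI D = weight f.
Proof.
by rewrite /gammaI; case: arg_minnP => [|f Df _]; [exact: IDF_const2 | exists f].
Qed.

Lemma gammaI_min (V : finType) (D : rel V) f : IDF D f -> gammaI D <= weight f.
Proof.
rewrite /gammaI; case: arg_minnP => [|g _ g_min /g_min //].
exact: IDF_const2.
Qed.

Lemma reinforcing_nonarcs (V : finType) (D : rel V) :
  2 < gammaI D -> reinforcing D (nonarcs D).
Proof.
move=> gt2; rewrite /reinforcing subxx /=; apply: leq_ltn_trans gt2.
case: (pickP V) => [x _ | V0]; last first.
  have [f _ ->] := gammaI_attained (add_arcs D (nonarcs D)).
  by rewrite /weight big_pred0.
pose f : {ffun V -> 'I_3} := [ffun u => if u == x then ord_max else ord0].
have -> : 2 = weight f.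
  rewrite /weight (bigD1 x) //= ffunE eqxx big1 // => u /negPf ux.
  by rewrite ffunE ux.
apply/gammaI_min/forallP=> v; apply/implyP; rewrite ffunE.
case: (eqVneq v x) => // vx _; apply/orP; right; apply/existsP; exists x.
by rewrite ffunE eqxx /add_arcs /= inE /= (eq_sym x) vx orbN.
Qed.

Lemma rI_attained (V : finType) (D : rel V) :
  2 < gammaI D -> exists2 R, reinforcing D R & rI D = #|R|.
Proof.
move=> gt2; rewrite /rI leqNgt gt2 /=.
by case: arg_minnP => [|R DR _]; [exact: reinforcing_nonarcs | exists R].
Qed.

Lemma rI_min (V : finType) (D : rel V) R : reinforcing D R -> rI D <= #|R|.
Proof.
rewrite /rI; case: (leqP (gammaI D) 2) => // gt2.
case: arg_minnP => [|S _ S_min /S_min //].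
exact: reinforcing_nonarcs.
Qed.

(* Main.v *)
Require Import Defs.
From mathcomp Require Import all_boot all_algebra.
From mathcomp Require Import zify.

(** If x has maximum out-degree, labelling x by 2, its out-neighbours by 0 and
    every other vertex by 1 is an IDF of weight n - Delta + 1. Each arc added
    from x to one of the n - Delta - 1 vertices it does not reach lowers this
    weight by one, so n - Delta - gamma + 2 such arcs bring it down to
    gamma - 1; there is room for them because gamma >= 3. *)

(** An arbitrary [x] is allowed because the bound is used twice at the same vertex: in [D], and
    after the arcs leaving [x] are added. *)
Lemma gammaI_outdeg (V : finType) (D : rel V) (x : V) :
  irreflexive D -> gammaI D + #|[set w | D x w]| <= #|V| + 1.
Proof.
move=> Dirr.
pose f : {ffun V -> 'I_3} :=
  [ffun u => if u == x then ord_max else if D x u then ord0 else inord 1].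
have Df : IDF D f.
  apply/forallP=> v; rewrite ffunE; case: (eqVneq v x) => // vx.
  case Dxv: (D x v); last by rewrite inordK.
  by apply/orP; right; apply/existsP; exists x; rewrite Dxv ffunE eqxx.
have wf : weight f = 2 + #|~: (x |: [set w | D x w])|.
  rewrite /weight (bigD1 x) //= ffunE eqxx -sum1_card; congr (_ + _).
  rewrite [RHS]big_mkcond [LHS]big_mkcond; apply: eq_bigr => u _.
  rewrite ffunE !inE; case: eqVneq => //= _.
  by case: (D x u); rewrite //= inordK.
(* Without a loop at [x], the union has one element more than the out-neighbourhood. *)
have := cardsC (x |: [set w | D x w]).
rewrite cardsU1 inE Dirr /=; have := gammaI_min Df; rewrite wf; lia.
Qed.

Lemma exists_subset_card (T : finType) (A : {set T}) (k : nat) :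
  k <= #|A| -> exists2 S : {set T}, S \subset A & #|S| = k.
Proof.
move=> leAk; exists [set u in take k (enum A)].
  by apply/subsetP=> u; rewrite inE => /mem_take; rewrite mem_enum.
by rewrite cardsE (card_uniqP _) ?take_uniq ?enum_uniq // size_takel // -cardE.
Qed.

Theorem theorem4p4 (V : finType) (D : rel V) (D_simple : irreflexive D)
    (D_ge3 : 3 <= gammaI D) :
  (Posz (rI D) <=
    Posz #|V| - Posz (max_outdeg D) - Posz (gammaI D) + 2)%R.
Proof.
(* A maximum out-degree is attained only over a nonempty [V]; over an empty one every weight is
   0. *)
have V_gt0 : 0 < #|V|.
  rewrite lt0n; apply/eqP => V0; move: D_ge3.
  have [f _ ->] := gammaI_attained D.
  by rewrite /weight big_pred0 // => x; have := card0_eq V0 x.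
have [x xmax] := eq_bigmax (fun v => #|[set w | D v w]|) V_gt0.
rewrite /max_outdeg xmax; set N := [set w | D x w].
pose M := ~: (x |: N).
have cardM : #|N| + #|M| + 1 = #|V|.
  by have := cardsC (x |: N); rewrite cardsU1 inE D_simple /= /M; lia.
have gammaD := @gammaI_outdeg V D x D_simple; rewrite -/N in gammaD.
(* As [#|M|] is n - Delta - 1, this size is n - Delta - gamma + 2. By [gammaD], gamma is at most
   [#|M| + 2], so the subtraction is not truncated and the final integer bound can be read off. *)
have [|S SM cardS] := @exists_subset_card V M (#|M| + 3 - gammaI D); first lia.
have SP u : u \in S -> (u != x) && ~~ D x u.
  by move/(subsetP SM); rewrite !inE negb_or.
pose R := [set (x, u) | u in S].
have memR u v : ((u, v) \in R) = (u == x) && (v \in S).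
  apply/imsetP/andP => [[w wS [-> ->]] // | [/eqP -> vS]].
  by exists v.
have DR_irr : irreflexive (add_arcs D R).
  move=> u; rewrite /add_arcs /= D_simple memR /=; apply/andP => -[/eqP -> /SP].
  by rewrite eqxx.
have outDR : [set w | add_arcs D R x w] = N :|: S.
  by apply/setP=> w; rewrite inE /add_arcs /= memR eqxx !inE.
have NS : #|N :|: S| = #|N| + #|S|.
  rewrite cardsU disjoint_setI0 ?cards0 ?subn0 // disjoint_sym.
  by apply/pred0P => u /=; apply/andP => -[/SP/andP[_ /negPf nD]]; rewrite inE nD.
(* Since [S] avoids [N], the out-degree of [x] grows by exactly [#|S|]. *)
have gammaDR := @gammaI_outdeg V _ x DR_irr; rewrite outDR NS in gammaDR.
have reinfR : reinforcing D R.
  apply/andP; split; last lia.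
  by apply/subsetP=> _ /imsetP[u /SP uS ->]; rewrite inE /= eq_sym.
have := rI_min reinfR; rewrite card_imset; first lia.
by move=> u v [].
Qed.
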